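(* Every $2$-path is star $5$-colorable.
   Context: Graphs are finite, with no loops or parallel edges. A star coloring of $G$ is a proper vertex coloring in which no path on four vertices (as a not necessarily induced subgraph) uses only two colors; $G$ is star $k$-colorable if it has a star coloring using at most $k$ colors. A $2$-tree is a graph constructed from a triangle by repeatedly adding a new vertex of degree $2$ adjacent to the two endpoints of an existing edge. A $2$-path is a $2$-tree whose triangles can be ordered $T_1,\dots,T_m$ so that for each $i\ge2$ the triangle $T_i$ shares exactly one edge with $T_{i-1}$ and shares no edge with $T_j$ for $j<i-1$. (Equivalently, starting with a triangle, each new vertex after the second triangle is attached to the two endpoints of an edge containing the last added vertex.) *)

(* Defs.v *)
From mathcomp Require Import all_boot.

Set Implicit Arguments.
Unset Strict Implicit.
Unset Printing Implicit Defensive.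

Record sgraph := SGraph {
  vert :> finType;
  adj : rel vert;
  adj_sym : symmetric adj;
  adj_irr : irreflexive adj }.

Section Graph.
Variable G : sgraph.

Definition edges : {set {set G}} :=
  [set [set u.1; u.2] | u : G * G & adj u.1 u.2].

(* Triangles are identified with their vertex sets. *)
Definition triangle (A : {set G}) : bool :=
  (#|A| == 3) && [forall x in A, forall y in A, (x != y) ==> adj x y].

Definition edges_in (A : {set G}) : {set {set G}} :=
  [set f in edges | f \subset A].

Definition shared_edges (A B : {set G}) : {set {set G}} :=
  edges_in A :&: edges_in B.

(* [two_tree_on S]: the subgraph induced by S arises from a triangle by
   repeatedly adding a vertex v whose neighbours among the vertices already
   present are exactly the two ends of an existing edge.  Each stage of the
   construction is the subgraph of G induced by the vertices present then, so
   only the vertex set has to be tracked. *)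
Inductive two_tree_on : {set G} -> Prop :=
| two_tree_triangle A : triangle A -> two_tree_on A
| two_tree_add S v x y :
    two_tree_on S -> v \notin S -> x \in S -> y \in S -> adj x y ->
    [set z in S | adj v z] = [set x; y] ->
    two_tree_on (v |: S).

Definition two_tree : Prop := two_tree_on [set: G].

Definition two_path : Prop :=
  two_tree /\
  exists s : seq {set G},
    [/\ uniq s,
        forall A, (A \in s) = triangle A,
        forall i, i.+1 < size s ->
          #|shared_edges (nth set0 s i.+1) (nth set0 s i)| = 1 &
        forall i j, i < size s -> j.+1 < i ->
          shared_edges (nth set0 s i) (nth set0 s j) = set0].

Definition proper_coloring (C : finType) (f : G -> C) : Prop :=
  forall x y, adj x y -> f x != f y.

Definition star_coloring (C : finType) (f : G -> C) : Prop :=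
  proper_coloring f /\
  forall a b c d : G,
    uniq [:: a; b; c; d] -> path (@adj G) a [:: b; c; d] ->
    2 < #|[set f a; f b; f c; f d]|.

Definition star_colorable (k : nat) : Prop :=
  exists f : G -> 'I_k, star_coloring f.

End Graph.

(* Main.v *)
Require Import Defs.
From mathcomp Require Import all_boot.

Set Implicit Arguments.
Unset Strict Implicit.
Unset Printing Implicit Defensive.

(** A 2-path can be built from a triangle by adding one vertex [v] at a time,
where [v] is joined to both ends of an edge [z u] of the last triangle [T] and
[z] is the vertex that came with [T]; so all present neighbours of [z] lie in
[T].  A greedy coloring along this construction needs only five colors.

Call a color [c] risky at [u] if [u] starts a path [u - x - w] with [w] colored
like [u] and [x] colored [c]: a new neighbour of [u] colored [c] would complete
a two-colored path on four vertices.  The invariant is that each vertex of the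
last triangle has at most one risky color.  Give [v] a color different from the
three colors of [T] and from the risky color of [u]; at most four colors are
excluded.

- No two-colored path on four vertices ends at [v].  If its second vertex is
  [u], the color of [v] would be risky at [u].  If it is [z], the third vertex
  is a neighbour of [z], hence in [T], and has a color denied to [v].  None has
  [v] inside, because the two neighbours of [v] are adjacent.
- The invariant survives.  No color becomes risky at [z] or [u], since [v] has
  a color absent from [T] and its neighbours [z] and [u] differ in color.  At
  [v] only the color of [u] can be risky, since the present neighbours of [z]
  are in [T].

That a 2-path has such a construction rests on a count.  A 2-tree on [n]
vertices has at most [n - 2] triangles, whereas each triangle of the sequence
meets its predecessor in two vertices and so contributes at most one vertex.
To cover all [n] vertices, every triangle after the first must contribute one
new vertex ([new_vertex]).  This excludes chance meetings of distant triangles,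
so each new vertex has exactly two earlier neighbours ([edge_before]), and as
[T_(i+2)] shares no edge with [T_i], it contains the newest vertex of
[T_(i+1)] ([newest_meet]). *)

(** * Star colorings of strips of triangles *)

Section Strip.
Variable G : sgraph.
Implicit Types (S T U A : {set G}) (u v w x y z : G).

(** [strip U T]: [U] is the set of vertices present and [T] the last triangle.
The last premise of [strip_add] says that [z] came with [T], in the only form
that the coloring needs; it holds for every vertex of the first triangle. *)
Inductive strip : {set G} -> {set G} -> Prop :=
| strip_triangle T : triangle T -> strip T T
| strip_add U T v z u :
    strip U T -> v \notin U -> z \in T -> u \in T -> adj z u ->
    [set x in U | adj v x] = [set z; u] ->
    [set x in U | adj z x] \subset T ->
    strip (v |: U) (v |: [set z; u]).

Definition risky (C : eqType) U (f : G -> C) u (c : C) : Prop :=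
  exists x w, [/\ x \in U, w \in U, adj u x, adj x w &
                  [/\ w != u, f w = f u & f x = c]].

(** Of a path [a - u - x - w] only [a != x] and [u != w] are required: [a = w]
is impossible when [a] and [x] share a color. *)
Definition star_on (C : eqType) U (f : G -> C) : Prop :=
  {in U &, forall x y, adj x y -> f x != f y} /\
  {in U &, forall a u, adj a u -> forall x w,
     x \in U -> w \in U -> adj u x -> adj x w ->
     a != x -> u != w -> f a = f x -> f u != f w}.

Lemma triangle_adj A x y :
  triangle A -> x \in A -> y \in A -> x != y -> adj x y.
Proof.
case/andP=> _ /forall_inP h xA yA.
by move/forall_inP: (h x xA) => /(_ y yA)/implyP.
Qed.

Lemma strip_sub U T : strip U T -> T \subset U.
Proof.
elim=> // {}U {}T v z u _ /subsetP sTU _ zT uT _ _ _.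
apply/subsetP=> x; rewrite !inE => /orP[->//|/orP[]/eqP->];
by rewrite sTU ?orbT.
Qed.

Lemma strip_card U T : strip U T -> #|T| = 3.
Proof.
elim=> [{}T /andP[/eqP]//|{}U {}T v z u sUT _ vU zT uT zu _ _].
have /subsetP sTU := strip_sub sUT.
have zNu : z != u by apply: contraTneq zu => ->; rewrite adj_irr.
rewrite cardsU1 cards2 zNu !inE negb_or.
by rewrite (contraNneq _ vU) ?(contraNneq _ vU) // => ->; rewrite sTU.
Qed.

Lemma fresh_color n (l : seq 'I_n) : size l < n -> exists c, c \notin l.
Proof.
move=> lt_l; apply/existsP; apply/contraT; rewrite negb_exists => /forallP h.
have : #|'I_n| <= #|l|.
  by apply/subset_leq_card/subsetP=> c _; have := h c; rewrite negbK.
by rewrite card_ord leqNgt (leq_ltn_trans (card_size l)).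
Qed.

Lemma triangle_rainbow A :
  triangle A -> exists f : G -> 'I_5, {in A &, injective f}.
Proof.
case/andP=> /eqP cA _.
exists (fun x => inord (index x (enum A))) => x y xA yA /(congr1 val) /=.
have lt5 t : t \in A -> index t (enum A) < 5.
  by move=> tA; apply: (@ltn_trans 3); rewrite // -cA cardE index_mem mem_enum.
by rewrite !inordK ?lt5 // => /index_inj->; rewrite ?mem_enum.
Qed.

(** The greedy coloring.  Carrying the bound on the risky colors of the last
triangle is what makes the induction go through. *)
Lemma strip_coloring U T : strip U T ->
  exists f : G -> 'I_5,
    star_on U f /\
    {in T, forall u, exists c, forall d, risky U f u d -> d = c}.
Proof.
elim=> [{}T triT | {}U {}T v z u sUT [f [[fP fS] fR]] vU zT uT zu Nv Nz].
  have [f fI] := triangle_rainbow triT; exists f; split; [split|].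
  - move=> x y xT yT xy; apply/eqP=> /(fI _ _ xT yT) e.
    by rewrite e adj_irr in xy.
  - move=> a u aT uT _ x w xT wT _ _ ax _ /(fI _ _ aT xT) e.
    by rewrite e eqxx in ax.
  - move=> u uT; exists ord0 => d [x [w [_ wT _ _ [wu /(fI _ _ wT uT) e _]]]].
    by rewrite e eqxx in wu.
have /subsetP sTU := strip_sub sUT.
have zU := sTU z zT; have uU := sTU u uT.
have vN y : y \in U -> (y == v) = false.
  by move=> yU; apply/eqP=> e; rewrite -e yU in vU.
have NvE x : x \in U -> adj v x -> x = z \/ x = u.
  move=> xU vx; have : x \in [set z; u] by rewrite -Nv inE xU.
  by rewrite !inE => /orP[]/eqP->; [left|right].
(* Besides the colors of T, only the risky color of u has to be avoided: a
   color risky at z is the color of a neighbour of z, hence a color of T. *)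
have [c0 c0P] := fR u uT.
have [c] : exists c, c \notin c0 :: [seq f t | t <- enum T].
  by apply: fresh_color; rewrite /= size_map -cardE (strip_card sUT).
rewrite inE negb_or => /andP[cNc0 cT].
have cNT t : t \in T -> f t != c.
  move=> tT; apply: contraNneq cT => <-.
  by apply/mapP; exists t; rewrite ?mem_enum.
have cNadj x : x \in U -> adj v x -> f x != c.
  by move=> xU /(NvE x xU)[]->; apply: cNT.
have NvP x y : x \in U -> y \in U -> adj v x -> adj v y -> x != y -> f x != f y.
  move=> xU yU /(NvE x xU) ex /(NvE y yU) ey.
  have fzu : f z != f u by apply: fP.
  case: ex => ->; case: ey => -> //; rewrite ?eqxx //.
  by rewrite [f u == _]eq_sym.
(* No two-colored path on four vertices ends at v. *)
have end_v b x w : b \in U -> x \in U -> w \in U ->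
    adj v b -> adj b x -> adj x w -> b != w -> f b = f w -> f x != c.
  move=> bU xU wU /(NvE b bU)[]-> bx xw bw fbw.
    by apply: cNT; apply: (subsetP Nz); rewrite inE xU.
  rewrite (c0P (f x)) 1?eq_sym //; exists x, w; split=> //.
  by split; rewrite // eq_sym.
pose f' x := if x == v then c else f x.
have f'v : f' v = c by rewrite /f' eqxx.
have f'U x : x \in U -> f' x = f x by rewrite /f' => /vN->.
have vv : adj v v = false by apply: adj_irr.
have in_vU x : x \in v |: U -> x = v \/ x \in U.
  by rewrite !inE => /orP[/eqP->|]; [left|right].
exists f'; split; [split|].
- move=> x y /in_vU[->|xU] /in_vU[->|yU]; rewrite ?vv ?f'v ?f'U //.
  + by rewrite eq_sym; apply: cNadj.
  + by rewrite adj_sym; apply: cNadj.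
  + exact: fP.
- move=> a b /in_vU[->|aU] /in_vU[->|bU] ab x w /in_vU[->|xU] /in_vU[->|wU];
    rewrite ?vv ?eqxx ?f'v ?f'U // in ab * => bx xw ax bw.
  + by move=> e; have := cNadj x xU; rewrite adj_sym xw -e eqxx => /(_ isT).
  + move=> cx; apply/eqP=> /(end_v b x w bU xU wU ab bx xw bw).
    by rewrite -cx eqxx.
  + move=> e; have := NvP a x aU xU; rewrite adj_sym ab => /(_ isT bx ax).
    by rewrite e eqxx.
  + by move=> _; apply: NvP; rewrite // adj_sym.
  + move=> e; apply: (end_v x b a) => //; rewrite 1?adj_sym // 1?eq_sym //.
  + by move=> e; apply: fS (ab) _ _ xU wU bx xw ax bw e.
(* The new vertex makes no color risky at a vertex of T. *)
- have risky_old y d : y \in T -> risky (v |: U) f' y d -> risky U f y d.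
    move=> yT; have yU := sTU y yT.
    case=> x [w [/in_vU[->|xU] /in_vU[->|wU] yx xw []]];
      rewrite ?vv ?f'v ?f'U // in xw * => wy fwy fx.
    + have := NvP w y wU yU xw; rewrite adj_sym => /(_ yx wy).
      by rewrite fwy eqxx.
    + by have := cNT y yT; rewrite fwy eqxx.
    + by exists x, w.
  move=> y; rewrite !inE => /orP[/eqP->|yzu]; last first.
    have yT : y \in T by case/orP: yzu => /eqP->.
    by have [d dP] := fR y yT; exists d => e /(risky_old _ _ yT)/dP.
  (* At v itself, a path through z leads to a vertex of T, whose color v does
     not have; so the only middle vertex is u. *)
  exists (f u) => d [x [w [/in_vU[->|xU] /in_vU[->|wU] yx xw []]]];
      rewrite ?vv ?eqxx ?f'v ?f'U // in yx xw * => wy fwy <-.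
  case: (NvE x xU yx) => ex; last by rewrite ex.
  have := cNT w; rewrite fwy eqxx => /(_ _)/negP[] //.
  by apply: (subsetP Nz); rewrite inE wU -ex.
Qed.

Lemma star_on_setT k (f : G -> 'I_k) : star_on [set: G] f -> star_coloring f.
Proof.
case=> fP fS; have P x y : adj x y -> f x != f y by apply: fP; rewrite inE.
split=> // a b c d; rewrite /= !inE !negb_or andbT.
case/and3P=> /and3P[_ aNc _] /andP[_ bNd] _ /and3P[ab bc /andP[cd _]].
have three (x y z : 'I_k) (D : {set 'I_k}) : x != y -> y != z -> x != z ->
    [set x; y; z] \subset D -> 2 < #|D|.
  move=> xy yz xz /subset_leq_card; apply: leq_trans.
  by rewrite -setUA cardsU1 cards2 yz !inE negb_or xy xz.
have [fac|fac] := eqVneq (f a) (f c).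
  apply: (three _ _ _ _ (P _ _ bc) (P _ _ cd)); last first.
    by apply/subsetP=> x; rewrite !inE => /orP[/orP[]|] ->; rewrite ?orbT.
  by apply: (fS a b _ _ ab c d _ _ bc cd aNc bNd fac); rewrite inE.
apply: (three _ _ _ _ (P _ _ ab) (P _ _ bc) fac).
by apply/subsetP=> x; rewrite !inE => /orP[/orP[]|] ->; rewrite ?orbT.
Qed.

Lemma strip_star_colorable T : strip [set: G] T -> star_colorable G 5.
Proof.
by case/strip_coloring=> f [fS _]; exists f; apply: star_on_setT.
Qed.

(** * Triangles in 2-trees *)

Definition triangles_in S : {set {set G}} :=
  [set A | triangle A & A \subset S].

(** In a 2-tree a new vertex lies in a single triangle, the one on its two
neighbours, so triangles are at least two fewer than vertices. *)
Lemma two_tree_triangles S : two_tree_on S ->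
  [/\ #|triangles_in S| + 2 <= #|S|,
      {in S, forall x, exists2 A, A \in triangles_in S & x \in A} &
      {in S &, forall x y, adj x y ->
         exists2 A, A \in triangles_in S & [set x; y] \subset A}].
Proof.
elim=> [A triA | {}S v x y _ [cS covS edgS] vS xS yS xy Nv].
  have [/eqP cA _] := andP triA.
  have AA : A \in triangles_in A by rewrite inE triA subxx.
  split; last 2 first.
  - by move=> x xA; exists A.
  - by move=> x y xA yA _; exists A; rewrite // subUset !sub1set xA.
  rewrite cA addn2 !ltnS -(cards1 A); apply/subset_leq_card/subsetP=> B.
  rewrite !inE => /andP[/andP[/eqP cB _] sBA].
  by rewrite eqEcard sBA cA cB.
have nv z : z \in S -> adj v z -> z \in [set x; y] by rewrite -Nv inE => ->.
have nv' z : z \in [set x; y] -> adj v z /\ z \in S.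
  by rewrite -Nv inE => /andP[].
have xNy : x != y by apply: contraTneq xy => ->; rewrite adj_irr.
set B := v |: [set x; y].
have vB : v \notin [set x; y] by apply: contra vS => /nv'[].
have cB : #|B| = 3 by rewrite cardsU1 cards2 vB xNy.
have triB : triangle B.
  rewrite /triangle cB eqxx; apply/forall_inP=> a aB; apply/forall_inP=> b bB.
  apply/implyP; case/setU1P: aB => [->|aB]; case/setU1P: bB => [->|bB];
    rewrite ?eqxx //.
  - by case: (nv' b bB).
  - by case: (nv' a aB); rewrite adj_sym.
  move: aB bB; rewrite !inE => /orP[]/eqP-> /orP[]/eqP->; rewrite ?eqxx //.
  by rewrite adj_sym.
have BS : B \in triangles_in (v |: S).
  by rewrite inE triB; apply: setUS; apply/subsetP=> z /nv'[].
have mono A : A \in triangles_in S -> A \in triangles_in (v |: S).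
  by rewrite !inE => /andP[->] /subset_trans->; rewrite // subsetUr.
split.
- rewrite cardsU1 vS add1n.
  apply: leq_trans (_ : #|B |: triangles_in S| + 2 <= _); last first.
    by rewrite cardsU1; case: (_ \notin _); rewrite ?ltnS // ltnW.
  rewrite leq_add2r; apply/subset_leq_card/subsetP=> A.
  rewrite !inE => /andP[triA sA]; rewrite triA /=.
  have [vA|vA] := boolP (v \in A); last first.
    apply/orP; right; apply/subsetP=> z zA; move/subsetP/(_ z zA): sA.
    by rewrite !inE; case: eqP zA vA => [->->|].
  have [/eqP cA _] := andP triA.
  apply/orP; left; rewrite eqEcard cA cB andbT; apply/subsetP=> z zA.
  rewrite in_setU1; case: eqVneq => //= zv; apply: nv.
    by move/subsetP/(_ z zA): sA; rewrite !inE (negPf zv).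
  by apply: triangle_adj triA _ _ _; rewrite // eq_sym.
- move=> z /setU1P[->|zS]; first by exists B; rewrite // setU11.
  by have [A /mono AS zA] := covS z zS; exists A.
- have sB z : z \in S -> adj v z -> [set v; z] \subset B.
    move=> zS vz; rewrite subUset !sub1set setU11.
    by rewrite in_setU1 nv ?orbT.
  move=> a b /setU1P[->|aS] /setU1P[->|bS]; rewrite ?adj_irr // => ab.
  + by exists B; rewrite ?sB.
  + by exists B; rewrite // setUC sB // adj_sym.
  by have [A /mono AS abA] := edgS a b aS bS ab; exists A.
Qed.

Lemma shared_pair A B x y :
  x \in A :&: B -> y \in A :&: B -> adj x y -> [set x; y] \in shared_edges A B.
Proof.
case/setIP=> xA xB /setIP[yA yB] xy.
have e : [set x; y] \in edges G by apply/imsetP; exists (x, y); rewrite ?inE.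
by rewrite inE !(inE, subUset, sub1set) e xA xB yA yB.
Qed.

Lemma card_meet A B : triangle A -> triangle B -> A != B ->
  shared_edges A B != set0 -> #|A :&: B| = 2.
Proof.
move=> /andP[/eqP cA _] /andP[/eqP cB _] AB /set0Pn[E].
rewrite !inE -andbA => /and4P[/imsetP[[x y] /=]].
rewrite inE /= => xy -> sA _ sB; apply/eqP; rewrite eqn_leq; apply/andP; split.
  rewrite -ltnS -cA; apply: proper_card; rewrite properEcard subsetIl /= ltnNge.
  apply: contra AB => leAI; rewrite eqEcard cA cB andbT.
  by apply/setIidPl/eqP; rewrite eqEcard subsetIl.
have xNy : x != y by apply: contraTneq xy => ->; rewrite adj_irr.
have <- : #|[set x; y]| = 2 by rewrite cards2 xNy.
by apply/subset_leq_card; rewrite subsetI sA sB.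
Qed.

(** * From the triangle sequence of a 2-path to a strip *)

(** The 2-tree enters only through [cover], [edge_cover] and [few_triangles],
the three conclusions of [two_tree_triangles]. *)
Section TriangleSequence.
Variable s : seq {set G}.
Local Notation T i := (nth set0 s i).

Definition before i : {set G} := \bigcup_(j < i) T j.

Lemma beforeP i x : reflect (exists2 j, j < i & x \in T j) (x \in before i).
Proof.
apply: (iffP bigcupP) => [[j _ xj]|[j ji xj]]; first by exists j.
by exists (Ordinal ji).
Qed.

Lemma beforeS i : before i.+1 = T i :|: before i.
Proof. by rewrite /before big_ord_recr setUC. Qed.

Lemma sub_before i : T i \subset before i.+1.
Proof. by rewrite beforeS subsetUl. Qed.

Hypothesis tri_s : forall A, (A \in s) = triangle A.
Hypothesis card_next :
  forall i, i.+1 < size s -> #|T i.+1 :&: T i| = 2.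
Hypothesis disj_far : forall i j, i < size s -> j.+1 < i ->
  shared_edges (T i) (T j) = set0.
Hypothesis cover : forall x, exists2 A, triangle A & x \in A.
Hypothesis edge_cover :
  forall x y, adj x y -> exists2 A, triangle A & [set x; y] \subset A.
Hypothesis few_triangles : size s + 2 <= #|G|.

Lemma tri_nth i : i < size s -> triangle (T i).
Proof. by move=> lt; rewrite -tri_s mem_nth. Qed.

Lemma card_nth i : i < size s -> #|T i| = 3.
Proof. by move=> /tri_nth/andP[/eqP]. Qed.

Lemma card_beforeS i : i.+1 < size s -> #|before i.+2| <= #|before i.+1|.+1.
Proof.
move=> lt; rewrite [before i.+2]beforeS cardsU card_nth // leq_subLR.
rewrite -addSnnS leq_add2r ltnS -(card_next lt).
exact/subset_leq_card/setIS/sub_before.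
Qed.

Lemma card_before_leq i k : i.+1 + k <= size s ->
  #|before (i.+1 + k)| <= #|before i.+1| + k.
Proof.
elim: k => [|k IHk]; first by rewrite !addn0.
rewrite !addnS => lt; apply: leq_trans (card_beforeS lt) _.
by rewrite ltnS IHk // ltnW.
Qed.

Lemma before_all : before (size s) = [set: G].
Proof.
apply/setP=> x; rewrite inE; apply/beforeP.
have [A] := cover x; rewrite -tri_s => As xA.
by exists (index A s); rewrite ?index_mem ?nth_index.
Qed.

(** If one triangle added no vertex, the triangles would cover at most
[size s + 1] vertices, contrary to [few_triangles]. *)
Lemma new_vertex i : i.+1 < size s -> exists2 v, v \notin before i.+1 &
   T i.+1 = v |: (T i.+1 :&: T i).
Proof.
move=> lt; have : ~~ (T i.+1 \subset before i.+1).
  apply/negP=> sT; have b1 : #|before 1| = 3.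
    by rewrite beforeS /before big_ord0 setU0 card_nth // (leq_trans _ lt).
  have bi := @card_before_leq 0 i; rewrite add1n b1 in bi.
  have := @card_before_leq i.+1 (size s - i.+2).
  rewrite subnKC // before_all cardsT beforeS (setUidPr sT) => /(_ (leqnn _)).
  move=> /(leq_trans few_triangles); have := bi (ltnW lt).
  move: #|before _| => b le_b /leq_trans.
  move=> /(_ _ (leq_add le_b (leqnn _))).
  by rewrite -{1}(subnKC lt) addnAC leq_add2r addn2 add3n ltnn.
case/subsetPn=> v vT vB; exists v => //; apply/esym/eqP.
have vNi : v \notin T i by apply: contra vB => /(subsetP (sub_before i)).
rewrite eqEcard subUset sub1set vT subsetIl /= cardsU1 !inE vT /= vNi.
by rewrite card_next // card_nth.
Qed.

Lemma meet_before i : i.+1 < size s ->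
  T i.+1 :&: before i.+1 \subset T i.
Proof.
case/new_vertex=> v vB eT; apply/subsetP=> x /setIP[].
by rewrite {1}eT => /setU1P[->|/setIP[]] //; rewrite (negPf vB).
Qed.

(** An edge between present vertices is not a later chord: a later triangle
containing it meets the earlier vertices inside its predecessor, so the edge
descends along the sequence until it reaches a present triangle. *)
Lemma edge_before i x y : i <= size s -> x \in before i -> y \in before i ->
  adj x y -> exists j, [/\ j < i, x \in T j & y \in T j].
Proof.
move=> le_i xi yi /edge_cover[A]; rewrite -tri_s subUset !sub1set => As /andP[].
rewrite -(nth_index set0 As); have := As; rewrite -index_mem.
elim: (index A s) => [|k IHk] lt xk yk.
  exists 0; split=> //; by case: i le_i xi yi => // _ /beforeP[].
have [ki|ik] := ltnP k.+1 i; first by exists k.+1.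
have sub : before i \subset before k.+1.
  apply/subsetP=> z /beforeP[j ji zj]; apply/beforeP; exists j => //.
  exact: leq_trans ji ik.
have in_k z : z \in before i -> z \in T k.+1 -> z \in T k.
  move=> zi zk; apply: (subsetP (meet_before lt)).
  by rewrite inE zk (subsetP sub).
by apply: IHk; [apply: ltnW | apply: in_k | apply: in_k].
Qed.

(** Otherwise the two vertices common to [T_(i+1)] and [T_i] would be in
[T_(i-1)] as well, and the edge joining them would be shared by [T_(i+1)] and
[T_(i-1)]. *)
Lemma newest_meet i : i.+1 < size s ->
  exists2 z, z \in T i.+1 :&: T i & z \notin before i.
Proof.
move=> lt; apply/subsetPn/negP=> sub.
have c2 := card_next lt.
have [x [y [xI yI xNy]]] : exists x y,
    [/\ x \in T i.+1 :&: T i, y \in T i.+1 :&: T i & x != y].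
  case/eqP/cards2P: c2 => x [y [xy ->]]; exists x, y.
  by rewrite !inE !eqxx orbT.
case: i => [|i] in lt sub c2 xI yI *.
  by have := subsetP sub x xI => /beforeP[].
have inI z : z \in T i.+2 :&: T i.+1 -> z \in T i.+2 :&: T i.
  move=> zI; have /setIP[z2 z1] := zI; rewrite inE z2 /=.
  apply: (subsetP (meet_before (ltnW lt))).
  by rewrite inE z1 (subsetP sub).
have xy : adj x y.
  have [xT _] := setIP xI; have [yT _] := setIP yI.
  exact: triangle_adj (tri_nth lt) xT yT xNy.
have := shared_pair (inI x xI) (inI y yI) xy.
by rewrite disj_far // inE.
Qed.

Lemma strip_before i : i < size s -> strip (before i.+1) (T i).
Proof.
elim: i => [|i IHi] lt.
  by rewrite beforeS /before big_ord0 setU0; apply/strip_triangle/tri_nth.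
have [v vB eT] := new_vertex lt; have [z zI zB] := newest_meet lt.
have /setIP[z1 z0] := zI.
have [u uNz eI] : exists2 u, u != z & T i.+1 :&: T i = [set z; u].
  have : #|(T i.+1 :&: T i) :\ z| == 1.
    by have := card_next lt; rewrite (cardsD1 z) zI add1n => -[->].
  case/cards1P=> u eu; exists u.
    by have := set11 u; rewrite -eu => /setD1P[].
  by rewrite -(setD1K zI) eu.
have uI : u \in T i.+1 :&: T i by rewrite eI !inE eqxx orbT.
have /setIP[u1 u0] := uI.
have v1 : v \in T i.+1 by rewrite eT setU11.
have sTB := subsetP (sub_before i).
have eB : before i.+2 = v |: before i.+1.
  rewrite beforeS {1}eT -setUA; congr (_ |: _); apply/setUidPr/subsetP=> x.
  by case/setIP=> _ /sTB.
rewrite eB eT eI; apply: (strip_add (IHi (ltnW lt)) vB z0 u0).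
- by apply: triangle_adj (tri_nth lt) z1 u1 _; rewrite eq_sym.
- rewrite -eI; apply/setP=> x; rewrite !inE.
  apply/andP/andP=> [[xB vx]|[x1 x0]].
    have xB2 : x \in before i.+2 by rewrite eB setU1r.
    have vB2 : v \in before i.+2 by rewrite eB setU11.
    have [j [lt_j vj xj]] := edge_before lt vB2 xB2 vx.
    have ej : j = i.+1.
      apply/eqP; rewrite eqn_leq -ltnS lt_j /= leqNgt; apply: contra vB => ji.
      by apply/beforeP; exists j.
    rewrite ej in xj; split=> //; apply: (subsetP (meet_before lt)).
    by rewrite inE xj.
  split; first exact: sTB.
  apply: triangle_adj (tri_nth lt) v1 x1 _.
  by apply: contraNneq vB => ->; apply: sTB.
- apply/subsetP=> x; rewrite inE => /andP[xB zx].
  have [j [lt_j zj xj]] := edge_before (ltnW lt) (sTB z z0) xB zx.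
  suff -> : i = j by [].
  apply/eqP; rewrite eqn_leq -[j <= i]ltnS lt_j andbT leqNgt.
  by apply: contra zB => ji; apply/beforeP; exists j.
Qed.
End TriangleSequence.

Lemma two_path_strip : two_path G -> exists T, strip [set: G] T.
Proof.
case=> /two_tree_triangles[few cov ecov] [s [s_uniq s_tri s_next s_far]].
have cov' x : exists2 A, triangle A & x \in A.
  have [|A] := cov x; rewrite ?inE // => /andP[triA _] xA; by exists A.
have ecov' x y : adj x y -> exists2 A, triangle A & [set x; y] \subset A.
  case/(ecov x y _ _)=> [||A]; rewrite ?inE // => /andP[triA _]; by exists A.
have card_s : size s + 2 <= #|G|.
  rewrite -(card_uniqP s_uniq) -cardsT; apply: leq_trans few.
  rewrite leq_add2r; apply/eq_leq/eq_card=> A.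
  by rewrite s_tri inE subsetT andbT.
have next2 i : i.+1 < size s -> #|nth set0 s i.+1 :&: nth set0 s i| = 2.
  move=> lt; apply: card_meet; rewrite -?s_tri ?mem_nth // 1?ltnW //.
    by rewrite nth_uniq // ?(ltnW lt) // gtn_eqF.
  by rewrite -cards_eq0 s_next.
have s_gt0 : 0 < size s.
  have /card_gt0P[x _] : 0 < #|G| by apply: leq_trans card_s; rewrite addn2.
  by have [A] := cov' x; rewrite -s_tri; case: (s).
exists (nth set0 s (size s).-1); rewrite -(before_all s_tri cov').
by rewrite -{1}(prednK s_gt0); apply: strip_before; rewrite ?prednK.
Qed.
End Strip.

Theorem theorem4p10 (G : sgraph) (hG : two_path G) : star_colorable G 5.
Proof.
have [T] := two_path_strip hG; exact: strip_star_colorable.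
Qed.
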